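(* Let $F$ be a mixed graph. Then: (i) $\theta(F)=1$ if and only if $F$ is uncollapsible. (ii) $\theta(F)=\infty$ if and only if $F$ admits a proper 2-coloring of its vertices (proper for the underlying undirected graph) in which all head vertices receive the same color. Otherwise $\theta(F)\le 2$. (iii) If $F$ has at most one directed edge and $\chi(F)\ge 3$, then $\theta(F)=1+\frac{1}{\chi(F)-2}$. (iv) Otherwise, i.e. if $F$ is collapsible and has at least two directed edges, then \[1+\frac{1}{\chi(F)}\le \theta(F)\le 1+\frac{1}{\chi(F)-2},\] where the right-hand side is interpreted as $+\infty$ when $\chi(F)=2$.
   Context: A mixed graph $G$ has a finite vertex set and an edge set; each edge is on a pair of distinct vertices, there is at most one edge on any pair, and each edge is either undirected ($uv$) or directed from a tail $u$ to a head $v$. A vertex is a head vertex (resp. tail vertex) if it is the head (resp. tail) of some directed edge. Let $e_u(G),e_d(G)$ be the numbers of undirected and directed edges, and $\alpha(G)=e_u(G)/\binom{v(G)}{2}$, $\beta(G)=e_d(G)/\binom{v(G)}{2}$. A mixed graph $F$ is a subgraph of $G$ ($F\subseteq G$) if $F$ can be obtained from $G$ by deleting vertices, deleting edges, and forgetting directions of some directed edges; equivalently there is an injection $\phi:V(F)\to V(G)$ such that each undirected edge $uv$ of $F$ is sent to a pair $\phi(u)\phi(v)$ joined by an edge of either type, and each directed edge $u\to v$ of $F$ is sent to the directed edge $\phi(u)\to\phi(v)$ of $G$. $G$ is $F$-free if $F\not\subseteq G$. The Turán density coefficient $\theta(F)$ is the maximum $\rho$ such that $\limsup_{n\to\infty}\max\{\alpha(G)+\rho\beta(G):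 G \text{ an } F\text{-free mixed graph on } n \text{ vertices}\}\le 1$; if $\max\{\beta(G)\}$ over $F$-free $n$-vertex $G$ tends to $0$, then $\theta(F)=\infty$. $\chi(F)$ denotes the chromatic number of the underlying undirected graph of $F$ (forget all directions). $F$ is uncollapsible if some two head vertices are adjacent or some two tail vertices are adjacent; otherwise $F$ is collapsible. *)

(* Defs.v *)
From HB Require Import structures.
From mathcomp Require Import all_boot all_order all_algebra.
From mathcomp Require Import all_classical all_reals all_analysis.
From mathcomp Require Import lra.
Import Order.TTheory GRing.Theory Num.Theory.
Import numFieldNormedType.Exports.

Set Implicit Arguments.
Unset Strict Implicit.
Unset Printing Implicit Defensive.

Local Open Scope ring_scope.

(* An undirected edge is a two-element set {u, v}; a directed edge is a pair
   (tail, head). *)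
Definition mixed_axiom (V : finType) (E : {set {set V}} * {set V * V}) : bool :=
  [forall e in E.1, #|e| == 2%N] &&
  [forall p in E.2,
     [&& p.1 != p.2, (p.2, p.1) \notin E.2 & [set p.1; p.2] \notin E.1]].

Record mixed_graph (V : finType) := MixedGraph {
  edges :> {set {set V}} * {set V * V};
  _ : mixed_axiom edges }.

HB.instance Definition _ (V : finType) := [isSub for @edges V].
HB.instance Definition _ (V : finType) := [Finite of mixed_graph V by <:].

Definition uedges (V : finType) (G : mixed_graph V) : {set {set V}} :=
  (edges G).1.
Definition dedges (V : finType) (G : mixed_graph V) : {set V * V} :=
  (edges G).2.

Definition undirected (V : finType) (G : mixed_graph V) : rel V :=
  fun u v => [set u; v] \in uedges G.
Definition directed (V : finType) (G : mixed_graph V) : rel V :=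
  fun u v => (u, v) \in dedges G.
Definition adjacent (V : finType) (G : mixed_graph V) : rel V :=
  fun u v => [|| undirected G u v, directed G u v | directed G v u].

Definition head_vertex (V : finType) (G : mixed_graph V) : pred V :=
  fun v => [exists u, directed G u v].
Definition tail_vertex (V : finType) (G : mixed_graph V) : pred V :=
  fun u => [exists v, directed G u v].

Definition uncollapsible (V : finType) (F : mixed_graph V) : bool :=
  [exists u, exists v, [&& head_vertex F u, head_vertex F v & adjacent F u v]]
  ||
  [exists u, exists v, [&& tail_vertex F u, tail_vertex F v & adjacent F u v]].
Definition collapsible (V : finType) (F : mixed_graph V) : bool :=
  ~~ uncollapsible F.

Definition proper_coloring (V : finType) (F : mixed_graph V) (C : finType)
    (c : {ffun V -> C}) : bool :=
  [forall u, forall v, adjacent F u v ==> (c u != c v)].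
Definition colorable (V : finType) (F : mixed_graph V) (k : nat) : bool :=
  [exists c : {ffun V -> 'I_k}, proper_coloring F c].

Lemma adjacent_neq (V : finType) (G : mixed_graph V) (u v : V) :
  adjacent G u v -> u != v.
Proof.
have /andP[/forall_inP U /forall_inP D] : mixed_axiom (edges G) by case: G.
case/or3P => h.
- by have := U _ h; rewrite cards2; case: (u != v).
- by have /and3P[] := D _ h.
- by have /and3P[/=] := D _ h; rewrite eq_sym.
Qed.

Lemma colorable_ex (V : finType) (F : mixed_graph V) :
  exists k, colorable F k.
Proof.
exists #|V|; apply/existsP; exists [ffun v => enum_rank v].
apply/forallP => u; apply/forallP => v; apply/implyP => /adjacent_neq.
by rewrite !ffunE (inj_eq enum_rank_inj).
Qed.

Definition chromatic_number (V : finType) (F : mixed_graph V) : nat :=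
  ex_minn (colorable_ex F).

Definition head_monochromatic_2colorable (V : finType) (F : mixed_graph V) :
    Prop :=
  exists c : {ffun V -> 'I_2}, proper_coloring F c /\
    exists i, forall v, head_vertex F v -> c v = i.

Definition subgraph (V W : finType) (F : mixed_graph V) (G : mixed_graph W) :
    bool :=
  [exists phi : {ffun V -> W},
    [&& injectiveb phi,
        [forall u, forall v, undirected F u v ==> adjacent G (phi u) (phi v)] &
        [forall u, forall v, directed F u v ==> directed G (phi u) (phi v)]]].

Definition free (V W : finType) (F : mixed_graph V) (G : mixed_graph W) : bool :=
  ~~ subgraph F G.

Definition alpha (R : realType) (n : nat) (G : mixed_graph 'I_n) : R :=
  #|uedges G|%:R / 'C(n, 2)%:R.
Definition beta (R : realType) (n : nat) (G : mixed_graph 'I_n) : R :=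
  #|dedges G|%:R / 'C(n, 2)%:R.

(* The default value 0 is only used when no graph on n vertices is F-free.
   It never exceeds the true maximum of the functions used below: if some graph
   on n vertices is F-free, then so is the edgeless one, where they vanish. *)
Definition max_free (R : realType) (V : finType) (F : mixed_graph V) (n : nat)
    (f : mixed_graph 'I_n -> R) : R :=
  \big[Num.max/0]_(G : mixed_graph 'I_n | free F G) f G.

Definition admissible (R : realType) (V : finType) (F : mixed_graph V)
    (rho : R) : Prop :=
  (limn_esup
     (fun n => (max_free F (fun G : mixed_graph 'I_n =>
                  alpha R G + rho * beta R G))%:E) <= 1)%E.

Definition beta_vanishes (R : realType) (V : finType) (F : mixed_graph V) :
    Prop :=
  ((fun n => max_free F (@beta R n)) @ \oo --> (0 : R))%classic.

Definition theta (R : realType) (V : finType) (F : mixed_graph V) : \bar R :=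
  if `[< beta_vanishes R F >] then +oo%E
  else ereal_sup [set rho%:E | rho in admissible (R := R) F]%classic.

Lemma card_edges_le (n : nat) (G : mixed_graph 'I_n) :
  (#|uedges G| + #|dedges G| <= 'C(n, 2))%N.
Proof.
have /andP[/forall_inP U /forall_inP D] : mixed_axiom (edges G) by case: G.
pose s (p : 'I_n * 'I_n) := [set p.1; p.2]%SET.
have sinj : {in dedges G &, injective s}.
  move=> [a b] [c d] abG cdG /setP abcd.
  have /and3P[/= ab ba _] := D _ abG.
  have : a \in [set c; d]%SET by rewrite -[_ \in _]abcd !inE eqxx.
  have : b \in [set c; d]%SET by rewrite -[_ \in _]abcd !inE eqxx orbT.
  rewrite !inE => /orP[] /eqP bE /orP[] /eqP aE.
  - by rewrite aE bE eqxx in ab.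
  - by rewrite aE bE cdG in ba.
  - by rewrite aE bE.
  - by rewrite aE bE eqxx in ab.
rewrite -(card_in_imset sinj).
have dis : [disjoint uedges G & (s @: dedges G)%SET].
  rewrite finset.disjoints_subset; apply/fintype.subsetP => e eE; rewrite !inE.
  apply/imsetP => -[p /D /and3P[_ _ pE] ep].
  by move: eE; rewrite ep (negbTE pE).
have -> : (#|uedges G| + #|s @: dedges G| = #|uedges G :|: s @: dedges G|)%N%SET.
  by rewrite cardsU finset.disjoint_setI0// cards0 subn0.
rewrite -[in 'C(n, 2)](card_ord n) -card_draws.
apply: fintype.subset_leq_card; apply/fintype.subsetP => e; rewrite !inE => /orP[/U //|].
by case/imsetP => p /D /and3P[p12 _ _] ->; rewrite cards2 p12.
Qed.

Lemma alpha_beta_le1 (R : realType) (n : nat) (G : mixed_graph 'I_n) :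
  alpha R G + beta R G <= 1.
Proof.
rewrite /alpha /beta -mulrDl -natrD.
have [->|C0] := posnP 'C(n, 2); first by rewrite invr0 mulr0.
by rewrite ler_pdivrMr ?ltr0n// mul1r ler_nat card_edges_le.
Qed.

Lemma limn_esup_le1P (R : realType) (u : nat -> R) :
  (limn_esup (fun n => (u n)%:E) <= 1)%E <->
  (forall e, 0 < e -> exists N, forall n, (N <= n)%N -> u n <= 1 + e).
Proof.
split=> [u1 e e0|H].
  have : (limn_esup (fun n => (u n)%:E) < (1 + e)%:E)%E.
    by apply: le_lt_trans u1 _; rewrite lte_fin ltrDl.
  rewrite /limn_esup /limf_esup => /ereal_inf_lt[_ [A [N _ NA] <-] Ae].
  exists N => n Nn; rewrite -lee_fin; apply: le_trans (ltW Ae).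
  by apply: ereal_sup_ubound; exists n => //; exact: NA.
apply/lee_addgt0Pr => e /H[N uN]; apply: ge_ereal_inf.
exists (ereal_sup ((fun n => (u n)%:E) @` [set n | (N <= n)%N])%classic).
  by exists [set n | (N <= n)%N]%classic => //; exists N.
by apply: ge_ereal_sup => _ [n /= Nn <-]; rewrite -EFinD lee_fin uN.
Qed.

(* theta F is a genuine maximum unless it is +oo by convention. *)
Lemma theta_max (R : realType) (V : finType) (F : mixed_graph V) :
  ~ beta_vanishes R F ->
  exists rho : R, [/\ theta R F = rho%:E, admissible F rho &
    forall rho', admissible F rho' -> rho' <= rho].
Proof.
move=> nb; rewrite /theta; case: asboolP => // _.
have alpha0 n (G : mixed_graph 'I_n) : 0 <= alpha R G by rewrite divr_ge0.
have beta0 n (G : mixed_graph 'I_n) : 0 <= beta R G by rewrite divr_ge0.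
pose b n := max_free F (@beta R n).
have [e e0 He] : exists2 e, 0 < e & forall N, exists2 n, (N <= n)%N & e <= b n.
  apply: contrapT => H; apply: nb; apply/cvgrPdist_lt => e e0.
  apply: contrapT => H'; apply: H; exists e => // N.
  apply: contrapT => H; apply: H'; exists N => // n Nn /=.
  rewrite sub0r normrN ger0_norm ?bigmax_ge_id// ltNge.
  by apply/negP => en; apply: H; exists n.
have adm0 : admissible F (0 : R).
  apply/limn_esup_le1P => d d0; exists 0%N => n _.
  apply: bigmax_le => [|G _]; first by rewrite addr_ge0// ltW.
  have := alpha_beta_le1 R G; have := beta0 n G; lra.
have ub s : admissible F s -> s <= 2 / e.
  move=> /limn_esup_le1P/(_ 1 ltr01)[N sN].
  have [n Nn en] := He N; have {}sN := sN n Nn.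
  have [s0|s0] := leP s 0; first by rewrite (le_trans s0)// divr_ge0// ltW.
  rewrite ler_pdivlMr//; apply: le_trans (_ : s * b n <= _).
    by rewrite ler_pM2l.
  rewrite -ler_pdivlMl//; apply: bigmax_le => [|G FG].
    by rewrite mulr_ge0// invr_ge0 ltW.
  rewrite ler_pdivlMl//; apply: le_trans (_ : alpha R G + s * beta R G <= _).
    by rewrite lerDr.
  by rewrite (le_trans _ sN)// (le_bigmax_cond _ (fun G => alpha R G + s * beta R G)).
pose S := [set s : R | admissible F s]%classic.
have supS : has_sup S by split; [exists 0 | exists (2 / e) => s /ub].
exists (sup S); split.
- by rewrite -ereal_sup_EFin//; case: supS.
- apply/limn_esup_le1P => d d0.
  have d2 : 0 < d / 2 by rewrite divr_gt0.
  have [s Ss sd] := sup_adherent d2 supS.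
  move/limn_esup_le1P: (Ss) => /(_ _ d2)[N sN]; exists N => n /sN {}sN.
  apply: bigmax_le => [|G FG]; first by rewrite addr_ge0// ltW.
  have GN : alpha R G + s * beta R G <= 1 + d / 2.
    by rewrite (le_trans _ sN)// (le_bigmax_cond _ (fun G => alpha R G + s * beta R G)).
  have b1 : beta R G <= 1 by have := alpha_beta_le1 R G; have := alpha0 n G; lra.
  have : (sup S - s) * beta R G <= d / 2.
    rewrite -[d / 2]mulr1; apply: ler_pM => //; last by lra.
    by rewrite subr_ge0; apply: ub_le_sup => //; case: supS.
  by lra.
- by move=> s Ss; apply: ub_le_sup => //; case: supS.
Qed.

(* Main.v *)
Require Import Defs.
From mathcomp Require Import all_boot all_order all_algebra.
From mathcomp Require Import all_classical all_reals all_analysis.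
From mathcomp Require Import ring lra zify.
Import Order.TTheory GRing.Theory Num.Theory.
(* MathComp-Analysis also defines [adjacent]. *)
Import Defs.

(* Upper bounds on theta come from balanced blow-ups of small patterns: a
   transitive tournament on k vertices when F has no proper k-coloring (or, for
   k = 2, none with monochromatic heads), and, for uncollapsible F, a small
   independent part joined to an undirected clique by edges that all leave it
   or all enter it.

   Lower bounds come from an Erdos-Stone type argument. If undirected edges
   weigh 1, directed ones 1 + 1/(r - 2), and the average weight of a pair is at
   least 1 + e, then some large vertex set has minimum weighted degree at least
   1 + e/4 times its size, and it contains large blow-ups of the complete graph
   on r vertices with one directed edge: starting from one part, averaging and
   pigeonhole on neighborhoods add one part at a time, the first extension
   being made along directed edges.  A collapsible F is contained in such a
   blow-up for r = chi(F) + 2, because heads and tails form two independent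
   sets that can be recolored with two new colors, and for r = chi(F) if F has
   at most one directed edge.  With weights 0 and 1 and r = 2, the same argument
   shows that beta vanishes for graphs with a 2-coloring with monochromatic
   heads. *)

Set Implicit Arguments.
Unset Strict Implicit.
Unset Printing Implicit Defensive.

Local Open Scope ring_scope.

(** * Mixed graphs and weighted edge counts *)

Lemma mixed_graphP (V : finType) (G : mixed_graph V) :
  (forall e, e \in uedges G -> #|e| = 2%N) /\
  (forall u v, directed G u v ->
     [/\ u != v, ~~ directed G v u & ~~ undirected G u v]).
Proof.
have /andP[/forall_inP U /forall_inP D] : mixed_axiom (edges G) by case: G.
by split=> [e /U/eqP//|u v /D/and3P[]].
Qed.

Lemma undirectedC (V : finType) (G : mixed_graph V) (u v : V) :
  undirected G u v = undirected G v u.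
Proof. by rewrite /undirected finset.setUC. Qed.

Lemma adjacentC (V : finType) (G : mixed_graph V) (u v : V) :
  adjacent G u v = adjacent G v u.
Proof. by rewrite /adjacent undirectedC [directed G u v || _]orbC. Qed.

Lemma sum_undirected (V : finType) (G : mixed_graph V) :
  (\sum_x \sum_y undirected G x y = 2 * #|uedges G|)%N.
Proof.
have [U _] := mixed_graphP G; rewrite pair_bigA /= -big_mkcond /=.
rewrite (partition_big (fun p => [set p.1; p.2]%SET) (mem (uedges G)))//=.
rewrite mulnC -sum_nat_const; apply: eq_bigr => e eG.
rewrite sum1_card; have /eqP/cards2P[u [v [uv eE]]] := U _ eG.
have -> : 2%N = #|[set (u, v); (v, u)]%SET|.
  by rewrite cards2 xpair_eqE negb_and uv.
apply: eq_card => -[x y]; rewrite !inE /= [_ \in _]/=.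
apply/andP/orP => [[_ /eqP]|].
  rewrite eE => /setP xyE.
  have := xyE x; have := xyE y; have := xyE u; have := xyE v.
  rewrite !inE !eqxx !orbT/= !xpair_eqE.
  move=> + + /esym/orP[]/eqP yE /esym/orP[]/eqP xE; rewrite xE yE ?eqxx ?orbT.
  - by rewrite orbb eq_sym (negPf uv).
  - by right.
  - by left.
  - by rewrite orbb (negPf uv).
case=> /eqP[-> ->]; split; rewrite /undirected -?eE ?eG//.
- by rewrite finset.setUC -eE.
- by rewrite finset.setUC -eE.
Qed.

Definition weight (R : realType) (V : finType) (G : mixed_graph V) (a b : R)
    (x y : V) : R :=
  a *+ undirected G x y + b *+ (directed G x y || directed G y x).

(** A pair carries at most one edge, so at most one summand is nonzero. The second bound controls
    the weight towards a part with few neighbours, the third the weight where directed edges are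
    rare. *)
Lemma weightP (R : realType) (V : finType) (G : mixed_graph V) (a b : R)
    (x y : V) : 0 <= a <= b ->
  [/\ 0 <= weight G a b x y, weight G a b x y <= b *+ adjacent G x y &
      weight G a b x y <= a + b *+ (directed G x y || directed G y x)].
Proof.
move=> /andP[a0 ab]; have [_ D] := mixed_graphP G; rewrite /weight /adjacent.
have := D x y; have := D y x; rewrite (undirectedC G y x).
case: (undirected G x y); case: (directed G x y); case: (directed G y x) => Dyx Dxy;
  by rewrite /= ?mulr1n ?mulr0n;
     try (by case: Dyx); try (by case: Dxy); split; lra.
Qed.

Lemma weightC (R : realType) (V : finType) (G : mixed_graph V) (a b : R)
    (x y : V) : weight G a b x y = weight G a b y x.
Proof. by rewrite /weight undirectedC orbC. Qed.

Lemma weightxx (R : realType) (V : finType) (G : mixed_graph V) (a b : R)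
    (x : V) : weight G a b x x = 0.
Proof.
have [_ D] := mixed_graphP G.
have nD : directed G x x = false by apply/negP => /D[]; rewrite eqxx.
have nU : undirected G x x = false.
  by apply/negP => xx; have := @adjacent_neq _ G x x; rewrite /adjacent xx eqxx => /(_ isT).
by rewrite /weight nD nU /= !mulr0n addr0.
Qed.

Lemma sum_weight (R : realType) (V : finType) (G : mixed_graph V) (a b : R) :
  \sum_x \sum_y weight G a b x y = 2 * (a * #|uedges G|%:R + b * #|dedges G|%:R).
Proof.
have [_ D] := mixed_graphP G.
have dE : (\sum_x \sum_y directed G x y = #|dedges G|)%N.
  rewrite pair_bigA /= -big_mkcond /= sum1_card; apply: eq_card => -[x y] //.
transitivity (a * (\sum_x \sum_y undirected G x y)%:R +
  b * ((\sum_x \sum_y directed G x y)%:R + (\sum_x \sum_y directed G y x)%:R)).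
  rewrite !natr_sum -big_split /= !mulr_sumr -big_split /=; apply: eq_bigr => x _.
  rewrite !natr_sum -big_split /= !mulr_sumr -big_split /=; apply: eq_bigr => y _.
  rewrite /weight -[a *+ _]mulr_natr -[b *+ _]mulr_natr -natrD; congr (_ * _ + _ * _%:R).
  by have := D x y; case: (directed G x y); case: (directed G y x) => // /(_ isT)[].
have dE' : (\sum_x \sum_y directed G y x = #|dedges G|)%N by rewrite exchange_big.
by rewrite sum_undirected dE' dE natrM; ring.
Qed.

(** * Averaging and pigeonhole tools *)

(* The penalty [|S|^2 + |S|] drops by exactly [2|S|] when a vertex leaves [S],
   so an optimal [S] has minimum degree at least [d |S|]. *)
Lemma large_min_degree (R : realType) (V : finType) (f : V -> V -> R) (b d : R)
    (K : nat) :
  0 < b -> 0 <= d -> (forall x y, f x y <= b) -> (forall x y, f x y = f y x) ->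
  (forall x, f x x = 0) ->
  d * (#|V|%:R ^+ 2 + #|V|%:R) + b * K%:R ^+ 2 <= \sum_x \sum_y f x y ->
  exists S : {set V}, (K <= #|S|)%N /\
    forall x, x \in S -> d * #|S|%:R <= \sum_(y in S) f x y.
Proof.
move=> b0 d0 fb fC fxx fK.
pose W (S : {set V}) := \sum_(x in S) \sum_(y in S) f x y.
pose phi S := W S - d * (#|S|%:R ^+ 2 + #|S|%:R).
case: (Order.TotalTheory.arg_maxP (i0 := [set: V]%SET) (P := xpredT) phi) => // S _ Smax'.
have Smax S' : phi S' <= phi S by exact: Smax'.
exists S; split.
  (* The full vertex set has [phi] at least [b K^2], whereas [phi S <= W S <= b |S|^2]. *)
  have := Smax [set: V]%SET; rewrite /phi /W cardsT.
  have -> : \sum_(x in [set: V]%SET) \sum_(y in [set: V]%SET) f x y =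
            \sum_x \sum_y f x y.
    by apply: eq_big => [x|x _]; last apply: eq_bigl => y; rewrite finset.in_setT.
  move=> h.
  have WS : W S <= b * #|S|%:R ^+ 2.
    apply: le_trans (_ : \sum_(x in S) \sum_(y in S) b <= _).
      by apply: ler_sum => x _; apply: ler_sum => y _.
    by rewrite !sumr_const -[b *+ _]mulr_natr -[_ *+ _]mulr_natr expr2 mulrA.
  have : b * K%:R ^+ 2 <= b * #|S|%:R ^+ 2.
    apply: le_trans WS; rewrite /W.
    have : 0 <= d * (#|S|%:R ^+ 2 + #|S|%:R).
      by rewrite mulr_ge0// addr_ge0// exprn_ge0.
    by move: h; rewrite /phi /W; lra.
  by rewrite ler_pM2l// -!natrX ler_nat leq_sqr.
move=> x xS.
have := Smax (S :\ x)%SET; rewrite /phi.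
have -> : W S = W (S :\ x)%SET + 2 * \sum_(y in S) f x y.
  rewrite /W (big_setD1 x)//=.
  have -> : \sum_(y in (S :\ x)%SET) \sum_(z in S) f y z =
    \sum_(y in (S :\ x)%SET) f y x + \sum_(y in (S :\ x)%SET) \sum_(z in (S :\ x)%SET) f y z.
    by rewrite -big_split /=; apply: eq_bigr => y _; rewrite (big_setD1 x).
  have -> : \sum_(y in (S :\ x)%SET) f y x = \sum_(y in S) f x y.
    by rewrite [RHS](big_setD1 x)//= fxx add0r; apply: eq_bigr => y _; rewrite fC.
  by ring.
rewrite (cardsD1 x S) xS /= add1n -natr1; set w := W _; set s := \sum_(y in S) _.
move=> h; set m : R := _%:R in h *; suff : d * (m + 1) * 2 <= 2 * s by lra.
by move: h; nra.
Qed.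

(** A reverse Markov inequality: elements with [g x < c] contribute at most [c] each, so the excess
    [h |S|] must come from the others, which give at most [C] each. *)
Lemma popular_elements (R : realType) (V : finType) (S : {set V}) (g : V -> R)
    (c h C : R) :
  0 <= c -> (forall x, x \in S -> g x <= C) ->
  (c + h) * #|S|%:R <= \sum_(x in S) g x ->
  h * #|S|%:R <= C * #|[set x in S | c <= g x]|%:R.
Proof.
move=> c0 gC; set X := [set x in S | c <= g x]%SET => hS.
have : \sum_(x in S) g x <= \sum_(x in S) (c + C *+ (x \in X)).
  apply: ler_sum => x xS; rewrite /X inE xS /=.
  case: (leP c (g x)) => [_|/ltW h1]; last by rewrite mulr0n addr0.
  by rewrite mulr1n; have := gC _ xS; lra.
rewrite big_split /= sumr_const -[c *+ _]mulr_natr sumrMnr.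
have -> : (\sum_(x in S) (x \in X) = #|X|)%N.
  rewrite -big_mkcondr /= sum1_card; apply: eq_card => x.
  by rewrite unfold_in /X !inE; case: (x \in S).
by rewrite -mulr_natr; lra.
Qed.

Lemma large_fiber (V T : finType) (X : {set V}) (D : {set T}) (h : V -> T)
    (t : nat) :
  (forall x, x \in X -> h x \in D) -> (#|D| * t < #|X|)%N ->
  exists y, (t < #|[set x in X | h x == y]|)%N.
Proof.
move=> hD; apply: contraPP => /forallNP H; apply/negP; rewrite -leqNgt.
rewrite -sum1_card (partition_big h (mem D))//= -sum_nat_const.
apply: leq_sum => y _; have /negP := H y; rewrite -leqNgt; apply: leq_trans.
by rewrite sum1_card; apply: subset_leq_card; apply/fintype.subsetP => x; rewrite !inE.
Qed.

Lemma subset_card (V : finType) (A : {set V}) (t : nat) :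
  (t <= #|A|)%N -> exists2 B : {set V}, B \subset A & #|B| = t.
Proof.
move=> tA; exists [set x in take t (enum A)]%SET.
  apply/fintype.subsetP => x; rewrite inE => /mem_take.
  by rewrite mem_enum.
rewrite cardsE; have /card_uniqP -> : uniq (take t (enum A)) by rewrite take_uniq// enum_uniq.
by rewrite size_take_min -cardE; apply/minn_idPl.
Qed.

(** * Large minimum weighted degree forces blow-ups *)

Definition min_weight (R : realType) (V : finType) (G : mixed_graph V)
    (a b d : R) (S : {set V}) : Prop :=
  forall x, x \in S -> d * #|S|%:R <= \sum_(y in S) weight G a b x y.

Lemma exists_nat_ge (R : realType) (c x : R) :
  0 < c -> exists M : nat, x <= c * M%:R.
Proof.
move=> c0; exists (Num.bound (x / c)).
rewrite -ler_pdivrMl// mulrC; have [x0|x0] := leP 0 (x / c).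
  exact/ltW/archi_boundP.
by apply: le_trans (ltW x0) _.
Qed.

(** Supplies the candidates for a new part: averaging finds many vertices of [S] that are heavy
    towards the given parts, and pigeonhole keeps those with equal neighbourhoods there. [X] may
    meet the parts, but vertices adjacent to all of [X] lie outside it. *)
Lemma homogeneous_vertices (R : realType) (a b e : R) (k t t' : nat) :
  0 <= a <= b -> 0 < b -> 0 < e -> (0 < k)%N ->
  exists M : nat, forall (V : finType) (G : mixed_graph V) (S : {set V})
    (P : nat -> {set V}),
  (M <= #|S|)%N -> min_weight G a b (a + e) S ->
  (forall i, (i < k)%N -> P i \subset S /\ #|P i| = t.+1) ->
  exists X : {set V}, [/\ X \subset S, #|X| = t'.+1,
    forall x, x \in X ->
      k%:R * t.+1%:R * (a + e / 2) <=
        \sum_(i < k) \sum_(u in P i) weight G a b x u &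
    forall x x' i u, x \in X -> x' \in X -> (i < k)%N -> u \in P i ->
      [/\ directed G x u = directed G x' u, directed G u x = directed G u x' &
          adjacent G x u = adjacent G x' u]].
Proof.
(* Three subsets (out-neighbours, in-neighbours, neighbours) of a union of at most [k * t.+1]
   vertices are recorded; each class should exceed [t']. *)
move=> ab b0 e0 k0; pose N := ((2 ^ (k * t.+1)) ^ 3 * t'.+1)%N.
have e2 : 0 < e / 2 by lra.
(* Averaging will give [e / 2 * |S| <= b * |Y|], so this [M] yields [|Y| > N]. *)
have [M HM] := exists_nat_ge (b * N%:R + b) e2.
exists M => V G S P MS degS PS.
have a0 : 0 <= a by case/andP: ab.
have kt0 : 0 < k%:R * t.+1%:R :> R by rewrite mulr_gt0// ltr0n.
pose g x := \sum_(i < k) \sum_(u in P i) weight G a b x u.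
pose Y := [set x in S | k%:R * t.+1%:R * (a + e / 2) <= g x]%SET.
have gle x : g x <= b * (k%:R * t.+1%:R).
  apply: le_trans (_ : \sum_(i < k) \sum_(u in P i) b <= _).
    apply: ler_sum => i _; apply: ler_sum => u _.
    have [_ h _] := weightP G x u ab; apply: le_trans h _.
    by case: adjacent => //; rewrite mulr0n ltW.
  rewrite (eq_bigr (fun=> b * t.+1%:R)) => [|i _]; last first.
    by have [_ <-] := PS i (ltn_ord i); rewrite sumr_const mulr_natr.
  by rewrite sumr_const card_ord -[_ *+ k]mulr_natr -mulrA [t.+1%:R * _]mulrC.
have Ybig : (N < #|Y|)%N.
  have := @popular_elements R V S g (k%:R * t.+1%:R * (a + e / 2))
    (k%:R * t.+1%:R * (e / 2)) (b * (k%:R * t.+1%:R)) _ (fun x _ => gle x) _.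
  move=> /(_ _ _)/wrap[].
    by rewrite mulr_ge0// ?(ltW kt0)//; lra.
    (* Double counting: every vertex of the parts lies in [S], hence has weight at least
       [(a + e) |S|] into [S]. *)
    rewrite /g exchange_big /=.
    under eq_bigr do rewrite exchange_big /=.
    apply: le_trans (_ : \sum_(i < k) \sum_(u in P i) (a + e) * #|S|%:R <= _).
      rewrite (eq_bigr (fun=> t.+1%:R * ((a + e) * #|S|%:R))) => [|i _]; last first.
        by have [_ <-] := PS i (ltn_ord i); rewrite sumr_const mulr_natl.
      rewrite sumr_const card_ord -[_ *+ k]mulr_natl -!mulrDr !mulrA.
      by rewrite le_eqVlt; apply/orP; left; apply/eqP; field.
    apply: ler_sum => i _; apply: ler_sum => u uP.
    have [/fintype.subsetP /(_ _ uP) uS _] := PS i (ltn_ord i).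
    by under eq_bigr do rewrite weightC; apply: degS.
  rewrite -/Y => h.
  have {h} : e / 2 * #|S|%:R <= b * #|Y|%:R.
    by rewrite -(ler_pM2l kt0); move: h; lra.
  have : e / 2 * M%:R <= e / 2 * #|S|%:R by rewrite ler_pM2l// ler_nat.
  move=> h1 h2; have : b * (N%:R + 1) <= b * #|Y|%:R by lra.
  by rewrite ler_pM2l// natr1 ler_nat.
pose U := (\bigcup_(i < k) P i)%SET.
have Ucard : (#|U| <= k * t.+1)%N.
  rewrite -[k in X in (_ <= X)%N]card_ord -sum_nat_const.
  rewrite (eq_bigr (fun i : 'I_k => #|P i|)) => [|i _]; last by have [] := PS i (ltn_ord i).
  rewrite /U; elim/big_rec2: _ => [|i m A _ mA]; first by rewrite cards0.
  by rewrite (leq_trans (leq_card_setU _ _))// leq_add2l.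
pose h x := ([set u in U | directed G x u]%SET, [set u in U | directed G u x]%SET,
  [set u in U | adjacent G x u]%SET).
have hD x : x \in Y -> h x \in finset.setX (finset.setX (powerset U) (powerset U)) (powerset U).
  by move=> _; rewrite !inE /=; apply/andP; split; [apply/andP; split|];
    apply/fintype.subsetP => u; rewrite inE => /andP[].
have [|y hy] := large_fiber (t := t'.+1) hD.
  apply: leq_ltn_trans Ybig; rewrite leq_mul2r !cardsX !card_powerset /=.
  by rewrite -!expnD -expnM leq_exp2l//; lia.
have [X Xsub Xcard] := subset_card (ltnW hy).
have {}Xsub x : x \in X -> x \in Y /\ h x = y.
  by move/(fintype.subsetP Xsub); rewrite inE => /andP[? /eqP].
exists X; split => //.
- by apply/fintype.subsetP => x /Xsub[]; rewrite inE => /andP[].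
- by move=> x /Xsub[]; rewrite inE => /andP[].
move=> x x' i u /Xsub[_ hx] /Xsub[_ hx'].
have /eqP : h x = h x' by rewrite hx hx'.
rewrite !xpair_eqE => /andP[/andP[]].
move=> /eqP/setP/(_ u) h1 /eqP/setP/(_ u) h2 /eqP/setP/(_ u) + ik uP.
have uU : u \in U by apply/bigcupP; exists (Ordinal ik).
by move: h1 h2; rewrite !inE uU /=.
Qed.

(** Distinct parts may be joined by edges of any type, since undirected edges of [F] may map to
    either; only the pair of parts 0 and 1 has a prescribed direction. Adjacency makes the parts
    disjoint. *)
Definition blowup_in (V : finType) (G : mixed_graph V) (S : {set V})
    (k t : nat) (P : nat -> {set V}) : Prop :=
  [/\ forall i, (i < k)%N -> P i \subset S /\ #|P i| = t.+1,
      forall i j x y, (i < j < k)%N -> x \in P i -> y \in P j -> adjacent G x y &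
      forall x y, x \in P 0%N -> y \in P 1%N -> directed G x y].

Definition forces_blowups (R : realType) (a b e : R) (k : nat) : Prop :=
  forall t, exists M : nat, forall (V : finType) (G : mixed_graph V) (S : {set V}),
  (M <= #|S|)%N -> min_weight G a b (a + e) S ->
  exists P, blowup_in G S k t P.

(* Weight [a + e] on average leaves room for a fixed proportion of directed
   edges, as undirected ones weigh at most [a]. *)
Lemma forces_blowups2 (R : realType) (a b e : R) :
  0 <= a <= b -> 0 < b -> 0 < e -> forces_blowups a b e 2.
Proof.
move=> ab b0 e0 t'.
have e2 : 0 < e / 2 by lra.
(* With at most [t'] out-neighbours and [t'] in-neighbours in a set of size [t.+1], the excess over
   weight [a] per vertex is at most [2 b t'], less than [e / 2 * t.+1]. *)
have [t Ht] := exists_nat_ge (b * (2 * t'.+1%:R)) e2.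
have [M HM] := homogeneous_vertices t t' ab b0 e0 (ltnSn 0).
exists (maxn M t.+1) => V G S; rewrite geq_max => /andP[MS tS] degS.
have [A AS At] := subset_card tS.
have [|X [XS Xt Xw Xhom]] := HM V G S (fun=> A) MS degS; first by [].
have [x0 x0X] : exists x, x \in X by apply/card_gt0P; rewrite Xt.
(* If [x0] has many out-neighbours in [A], then [X] becomes part 0; if it has many in-neighbours,
   [X] becomes part 1. By homogeneity [x0] speaks for all of [X]. *)
pose O := [set u in A | directed G x0 u]%SET.
pose I := [set u in A | directed G u x0]%SET.
have OIcard : (t'.+1 <= #|O|)%N || (t'.+1 <= #|I|)%N.
  apply: contraT; rewrite negb_or -!leqNgt => /andP[Ot It].
  have := Xw _ x0X; rewrite big_ord1 mul1r.
  have : \sum_(u in A) weight G a b x0 u <=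
         \sum_(u in A) (a + (b *+ (u \in O) + b *+ (u \in I))).
    apply: ler_sum => u uA; have [_ _ h] := weightP G x0 u ab; apply: le_trans h _.
    rewrite /O /I !inE uA /= lerD2l; case: (directed G x0 u); case: (directed G u x0);
      by rewrite /= ?mulr1n ?mulr0n ?addr0 ?add0r // lerDl ltW.
  have cardE (B : {set V}) : B \subset A -> \sum_(u in A) b *+ (u \in B) = b * #|B|%:R.
    move=> /fintype.subsetP BA; rewrite sumrMnr mulr_natr; congr (_ *+ _).
    rewrite -big_mkcondr /= sum1_card; apply: eq_card => u; rewrite unfold_in.
    by case: (boolP (u \in B)) => [/BA ->|]; rewrite ?andbF.
  rewrite !big_split /= !cardE; last 2 first.
  - by apply/fintype.subsetP => u; rewrite inE => /andP[].
  - by apply/fintype.subsetP => u; rewrite inE => /andP[].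
  rewrite sumr_const At -[a *+ _]mulr_natr => h1 h2.
  have : b * #|O|%:R <= b * t'%:R by rewrite ler_pM2l// ler_nat.
  have : b * #|I|%:R <= b * t'%:R by rewrite ler_pM2l// ler_nat.
  move: Ht h1 h2; rewrite -(natr1 t) -(natr1 t'); lra.
have AS' (B : {set V}) : B \subset A -> B \subset S by move=> BA; exact: fintype.subset_trans BA AS.
have build (B : {set V}) : B \subset A -> forall P, P = (fun i => if i == 0%N then B else X) \/
    P = (fun i => if i == 0%N then X else B) ->
    (#|B| = t'.+1) -> (forall x y, x \in P 0%N -> y \in P 1%N -> directed G x y) ->
    exists P, blowup_in G S 2 t' P.
  move=> BA P PE Bt PD; exists P; split => //.
    by case: PE => -> [|[|//]] _ /=; split => //; apply: AS'.
  move=> i j x y ij; have [-> ->] : i = 0%N /\ j = 1%N by clear -ij; lia.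
  move=> xP yP.
  by rewrite /adjacent PD ?orbT.
case/orP: OIcard => /subset_card[B BO Bt].
- have BA : B \subset A.
    by apply: (fintype.subset_trans BO); apply/fintype.subsetP => u; rewrite inE => /andP[].
  apply: (build B BA _ (or_intror erefl) Bt) => x y /= xX yB.
  have := fintype.subsetP BO _ yB; rewrite inE => /andP[yA].
  by have [-> _ _] := Xhom x x0 0%N y xX x0X isT yA.
- have BA : B \subset A.
    by apply: (fintype.subset_trans BO); apply/fintype.subsetP => u; rewrite inE => /andP[].
  apply: (build B BA _ (or_introl erefl) Bt) => x y /= xB yX.
  have := fintype.subsetP BO _ xB; rewrite inE => /andP[xA].
  by have [_ -> _] := Xhom y x0 0%N x yX x0X isT xA.
Qed.

(* A vertex of weight more than [a k t] to a blow-up of [k] parts of size [t]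
   has many neighbours in every part, as [k - 1] parts contribute at most
   [b (k - 1) t <= a k t]. *)
Lemma forces_blowupsS (R : realType) (a b e : R) (k : nat) :
  0 <= a <= b -> 0 < b -> 0 < e -> k.+1%:R * b <= k.+2%:R * a ->
  forces_blowups a b e k.+2 -> forces_blowups a b e k.+3.
Proof.
move=> ab b0 e0 kab IH t'.
have e2 : 0 < e / 2 by lra.
have [t Ht] := exists_nat_ge (b * t'.+1%:R) e2.
have [M1 HM1] := IH t.
have [M2 HM2] := homogeneous_vertices t t' ab b0 e0 (ltn0Sn k.+1).
exists (maxn M1 M2) => V G S; rewrite geq_max => /andP[MS1 MS2] degS.
have [P [PS Padj Pdir]] := HM1 V G S MS1 degS.
have [X [XS Xt Xw Xhom]] := HM2 V G S P MS2 degS PS.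
have [x0 x0X] : exists x, x \in X by apply/card_gt0P; rewrite Xt.
pose N i := [set u in P i | adjacent G x0 u]%SET.
have Ncard i : (i < k.+2)%N -> (t'.+1 <= #|N i|)%N.
  move=> ik; rewrite leqNgt ltnS; apply/negP => Nt.
  have := Xw _ x0X; rewrite (bigD1 (Ordinal ik))//=.
  have : \sum_(u in P i) weight G a b x0 u <= b * t'%:R.
    apply: le_trans (_ : \sum_(u in P i) b *+ (u \in N i) <= _).
      apply: ler_sum => u uP; have [_ h _] := weightP G x0 u ab.
      by apply: le_trans h _; rewrite inE uP.
    rewrite sumrMnr -[_ *+ _]mulr_natr ler_pM2l// ler_nat; apply: leq_trans Nt.
    rewrite -big_mkcondr /= sum1_card; apply: subset_leq_card.
    by apply/fintype.subsetP => u; rewrite unfold_in => /andP[].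
  have : \sum_(j < k.+2 | j != Ordinal ik) \sum_(u in P j) weight G a b x0 u <=
         k.+1%:R * (b * t.+1%:R).
    apply: le_trans (_ : \sum_(j < k.+2 | j != Ordinal ik) b * t.+1%:R <= _).
      apply: ler_sum => j _; have [_ <-] := PS j (ltn_ord j).
      rewrite mulr_natr -sumr_const; apply: ler_sum => u _.
      have [_ h _] := weightP G x0 u ab; apply: le_trans h _.
      by case: adjacent => //; rewrite mulr0n ltW.
    rewrite sumr_const -[_ *+ _]mulr_natl; set m := #|_|.
    by have -> : m = k.+1 by rewrite /m (cardC1 (Ordinal ik)) card_ord.
  set rest := \sum_(j < _ | _) _; set part := \sum_(u in _) _ => h1 h2 h3.
  have h4 : k.+1%:R * b * t.+1%:R <= k.+2%:R * a * t.+1%:R by rewrite ler_pM2r.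
  have h5 : t%:R * (e / 2) <= k.+2%:R * t.+1%:R * (e / 2).
    by rewrite ler_pM2r// -natrM ler_nat mulSn (leq_trans (leqnSn t))// leq_addr.
  by move: Ht h1 h2 h3 h4 h5; rewrite -(natr1 t) -(natr1 t'); lra.
have NP i : N i \subset P i by apply/fintype.subsetP => u; rewrite inE => /andP[].
have /choice[Q HQ] i : exists B : {set V}, (i < k.+2)%N -> B \subset N i /\ #|B| = t'.+1.
  case: (ltnP i k.+2) => [/Ncard/subset_card[B BN Bt]|_]; first by exists B.
  by exists finset.set0.
have QN i u : (i < k.+2)%N -> u \in Q i -> u \in P i /\ adjacent G x0 u.
  by move=> /HQ[/fintype.subsetP QN _] /QN; rewrite inE => /andP.
(* [X] comes last, so the directed pair of parts keeps the indices 0 and 1. *)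
exists (fun i => if (i < k.+2)%N then Q i else X); split.
- move=> i ik; case: ifP => // ik2; have [QiN Qt] := HQ _ ik2; split => //.
  apply: (fintype.subset_trans QiN); apply: fintype.subset_trans (NP i) _.
  by have [] := PS i ik2.
- move=> i j x y /andP[ij jk]; rewrite (leq_trans ij (_ : (j <= k.+2)%N))//.
  have ik2 : (i < k.+2)%N by apply: leq_trans ij _.
  case: ifP => jk2 /(QN _ _ ik2)[xP x0x].
    by move=> /(QN _ _ jk2)[yP _]; apply: (Padj i j); rewrite ?ij.
  move=> yX; rewrite adjacentC.
  by have [_ _ ->] := Xhom y x0 i x yX x0X ik2 xP.
- by move=> x y /= /(QN 0%N)[]// xP _ /(QN 1%N)[]// yP _; apply: Pdir.
Qed.

(** The condition says [b / a <= 1 + 1 / k] when [a] and [k] are positive. Since [a <= b], it passes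
    to smaller [k], as the induction requires. *)
Lemma forces_blowups_all (R : realType) (a b e : R) (k : nat) :
  0 <= a <= b -> 0 < b -> 0 < e -> k%:R * b <= k.+1%:R * a ->
  forces_blowups a b e k.+2.
Proof.
move=> ab b0 e0; elim: k => [_|k IH kab]; first exact: forces_blowups2.
apply: forces_blowupsS => //; apply: IH.
by case/andP: ab => a0 ab; move: kab; rewrite -(natr1 k.+1) -(natr1 k); lra.
Qed.

(** * Embedding F in blow-ups; lower bounds on theta *)

(* A homomorphism from [F] to the complete graph on [0, ..., k - 1] whose only
   directed edge is [0 -> 1]. *)
Definition directed_edge_coloring (V : finType) (F : mixed_graph V) (k : nat)
    (c : V -> nat) : Prop :=
  [/\ forall v, (c v < k)%N,
      forall u v, adjacent F u v -> c u != c v &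
      forall u v, directed F u v -> c u = 0%N /\ c v = 1%N].

Lemma subgraph_blowup (V W : finType) (F : mixed_graph V) (G : mixed_graph W)
    (S : {set W}) (k t : nat) (P : nat -> {set W}) (c : V -> nat) :
  directed_edge_coloring F k c -> blowup_in G S k t P -> (#|V| <= t.+1)%N ->
  subgraph F G.
Proof.
move=> [ck cadj cdir] [PS Padj Pdir] Vt.
(* Each vertex takes the position given by its own rank in the part of its color; distinct ranks
   separate vertices of equal color. *)
have /choice[phi phiP] v : exists w,
    w \in P (c v) /\ index w (enum (P (c v))) = enum_rank v.
  have [_ Pt] := PS _ (ck v).
  have [w0 _] : exists w, w \in P (c v) by apply/card_gt0P; rewrite Pt.
  have rt : (enum_rank v < size (enum (P (c v))))%N.
    by rewrite -cardE Pt (leq_trans (ltn_ord _)).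
  exists (nth w0 (enum (P (c v))) (enum_rank v)).
  by rewrite -mem_enum mem_nth// index_uniq// enum_uniq.
have Padj' i j x y : (i < k)%N -> (j < k)%N -> i != j -> x \in P i -> y \in P j ->
    adjacent G x y.
  move=> ik jk; case: (ltngtP i j) => // ij _ xP yP.
    by apply: (Padj i j) => //; rewrite ij.
  by rewrite adjacentC; apply: (Padj j i) => //; rewrite ij.
have phi_inj : injective phi.
  move=> u v uv; have [uP ui] := phiP u; have [vP vi] := phiP v.
  have [cuv|cuv] := eqVneq (c u) (c v).
    by apply/enum_rank_inj/val_inj; rewrite /= -ui -vi uv cuv.
  have := Padj' _ _ _ _ (ck u) (ck v) cuv uP vP.
  by rewrite uv => /adjacent_neq; rewrite eqxx.
apply/existsP; exists [ffun v => phi v]; apply/and3P; split.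
- by apply/injectiveP => u v; rewrite !ffunE => /phi_inj.
- apply/forallP => u; apply/forallP => v; apply/implyP => uv; rewrite !ffunE.
  have [uP _] := phiP u; have [vP _] := phiP v.
  by apply: Padj' uP vP => //; apply: cadj; rewrite /adjacent uv.
- apply/forallP => u; apply/forallP => v; apply/implyP => uv; rewrite !ffunE.
  have [uP _] := phiP u; have [vP _] := phiP v; have [cu cv] := cdir _ _ uv.
  by rewrite cu in uP; rewrite cv in vP; apply: Pdir.
Qed.

Lemma double_bin2 (R : realType) (n : nat) :
  2 * 'C(n, 2)%:R = n%:R * (n%:R - 1) :> R.
Proof.
elim: n => [|n IH]; first by rewrite mulr0 mul0r.
by rewrite binS bin1 natrD mulrDr IH -natr1; ring.
Qed.

Lemma free_density_le (R : realType) (V : finType) (F : mixed_graph V) (a b : R)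
    (k : nat) (c : V -> nat) :
  0 <= a <= b -> 0 < b -> k%:R * b <= k.+1%:R * a ->
  directed_edge_coloring F k.+2 c ->
  forall e, 0 < e -> exists N : nat, forall n, (N <= n)%N ->
  forall G : mixed_graph 'I_n, free F G ->
    a * alpha R G + b * beta R G <= a + e.
Proof.
move=> ab b0 kab cF e e0; have a0 : 0 <= a by case/andP: ab.
have e4 : 0 < e / 4 by lra.
have [M HM] := forces_blowups_all ab b0 e4 kab #|V|.
have e34 : 0 < 3 * e / 4 by lra.
(* For [n >= N] the surplus [3e/4 n^2] of [(a + e) n (n - 1)] over [(a + e/4) (n^2 + n)] absorbs the
   linear terms and [b M^2]. *)
have [N HN] := exists_nat_ge (2 * a + 5 * e / 4 + b * M%:R ^+ 2) e34.
exists (maxn 2 N) => n; rewrite geq_max => /andP[n2 Nn] G FG.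
rewrite leNgt; apply/negP => dens; move/negP: FG; apply.
have C0 : 0 < 'C(n, 2)%:R :> R by rewrite ltr0n bin_gt0.
have [|||||S [MS degS]] := @large_min_degree R 'I_n (weight G a b) b (a + e / 4) M b0.
- lra.
- move=> x y; have [_ h _] := weightP G x y ab; apply: le_trans h _.
  by case: adjacent => //; rewrite mulr0n ltW.
- exact: weightC.
- exact: weightxx.
- rewrite sum_weight card_ord.
  have {dens} : (a + e) * (n%:R * (n%:R - 1)) <=
      2 * (a * #|uedges G|%:R + b * #|dedges G|%:R).
    rewrite -double_bin2 mulrCA ler_pM2l// -ler_pdivlMr//.
    by apply: ltW; move: dens; rewrite /alpha /beta mulrDl !mulrA.
  have n1 : 1 <= n%:R :> R by rewrite ler1n ltnW.
  have : 3 * e / 4 * N%:R <= 3 * e / 4 * n%:R by rewrite ler_pM2l// ler_nat.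
  have bM : 0 <= b * M%:R ^+ 2 by rewrite mulr_ge0 ?exprn_ge0// ltW.
  move: HN; set B := b * _ in bM *; set m : R := n%:R in n1 * => h1 h2 h3.
  have : m * (2 * a + 5 * e / 4 + B) <= m * (3 * e / 4 * m).
    by rewrite ler_pM2l; lra.
  have : B <= m * B by rewrite ler_peMl.
  by rewrite expr2; move: h3; lra.
have [P PG] := HM _ G S MS degS.
exact: subgraph_blowup cF PG (leqnSn _).
Qed.

(** With [a = 1] and [b = 1 + 1 / k.+1], the weight condition of [free_density_le] holds with
    equality. *)
Lemma theta_ge (R : realType) (V : finType) (F : mixed_graph V) (k : nat)
    (c : V -> nat) :
  directed_edge_coloring F k.+3 c -> ((1 + 1 / k.+1%:R)%:E <= theta R F)%E.
Proof.
move=> cF; rewrite /theta; case: asboolP => _; first exact: leey.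
apply: ereal_sup_ubound; exists (1 + 1 / k.+1%:R) => //.
have : 0 < 1 / k.+1%:R :> R by rewrite divr_gt0// ltr0n.
have : k.+1%:R * (1 / k.+1%:R) = 1 :> R by rewrite mulrCA mulfV ?mulr1 ?pnatr_eq0.
move: (1 / k.+1%:R) => i ki i0.
have ab : (0 : R) <= (1 : R) <= 1 + i by rewrite ler01 lerDl ltW.
apply/limn_esup_le1P => e e0.
have [||N HN] := @free_density_le R V F 1 (1 + i) k.+1 c ab _ _ cF e e0.
- lra.
- by rewrite -(natr1 k.+1); lra.
exists N => n Nn; apply: bigmax_le => [|G FG]; first by lra.
by rewrite -[alpha R G]mul1r; apply: HN.
Qed.

Lemma beta_vanishes_coloring (R : realType) (V : finType) (F : mixed_graph V)
    (c : V -> nat) :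
  directed_edge_coloring F 2 c -> beta_vanishes R F.
Proof.
move=> cF; apply/cvgrPdist_lt => e e0.
have e2 : 0 < e / 2 by lra.
have [|||N HN] := @free_density_le R V F 0 1 0 c _ _ _ cF (e / 2) e2; try lra.
exists N => // n Nn /=.
rewrite sub0r normrN ger0_norm ?bigmax_ge_id//.
apply: le_lt_trans (_ : e / 2 < e); last by lra.
apply: bigmax_le => [|G FG]; first exact: ltW.
by have := HN n Nn G FG; lra.
Qed.

(** * Blow-ups of patterns; upper bounds on theta *)

(* [ud i i] is allowed: part [i] of a blow-up then spans a complete graph. *)
Definition pattern (I : finType) (ud di : rel I) : Prop :=
  symmetric ud /\ forall i j, di i j -> ~~ di j i && ~~ ud i j.

(** The obstruction to avoid: a copy of [F] in a blow-up of the pattern projects to such a map. *)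
Definition pattern_hom (V I : finType) (F : mixed_graph V) (ud di : rel I)
    (h : V -> I) : Prop :=
  (forall u v, directed F u v -> di (h u) (h v)) /\
  (forall u v, adjacent F u v -> [|| ud (h u) (h v), di (h u) (h v) | di (h v) (h u)]).

Lemma pattern_blowup (V I : finType) (ud di : rel I) (col : V -> I) :
  pattern ud di -> exists G : mixed_graph V,
    (forall x y, undirected G x y = (x != y) && ud (col x) (col y)) /\
    (forall x y, directed G x y = di (col x) (col y)).
Proof.
move=> [udC diP].
pose U := [set e : {set V} | (#|e| == 2) &&
  [forall x in e, forall y in e, (x != y) ==> ud (col x) (col y)]]%SET.
pose D := [set p : V * V | di (col p.1) (col p.2)]%SET.
have UE x y : ([set x; y]%SET \in U) = (x != y) && ud (col x) (col y).
  rewrite inE cards2; case: (eqVneq x y) => //= xy.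
  apply/idP/idP => [/forall_inP/(_ x)|h].
    rewrite !inE eqxx => /(_ isT)/forall_inP/(_ y).
    by rewrite !inE eqxx orbT xy => /(_ isT).
  apply/forall_inP => z /set2P zE; apply/forall_inP => w /set2P wE.
  apply/implyP; case: zE => ->; case: wE => ->; rewrite ?eqxx// => _.
  by rewrite udC.
have ax : mixed_axiom (U, D).
  apply/andP; split; apply/forall_inP.
    by move=> e /=; rewrite inE => /andP[].
  move=> [x y] /=; rewrite UE !inE /= => xy.
  have /andP[nyx nud] := diP _ _ xy.
  rewrite nyx (negPf nud) andbF !andbT; apply: contraTneq xy => xy.
  by apply/negP => h; have := diP _ _ h; rewrite xy in h *; rewrite h.
exists (MixedGraph ax); split=> x y; first exact: UE.
by rewrite /directed /dedges inE.
Qed.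

(* The blow-up with [k] parts of size [q] lives on an ordinal, as [alpha] and
   [beta] require; [col] gives the part of a vertex. *)
Lemma sum_blocks (k q : nat) (r : 'I_k -> 'I_k -> nat) :
  let col (x : 'I_#|{: 'I_k * 'I_q}|) := (enum_val x).1 in
  (\sum_x \sum_y r (col x) (col y) = q ^ 2 * \sum_i \sum_j r i j)%N.
Proof.
move=> col; rewrite -(big_enum_val (A := {: 'I_k * 'I_q})
  (fun z => \sum_y r z.1 (col y))%N) /=.
under eq_bigr => z _ do rewrite -(big_enum_val (A := {: 'I_k * 'I_q})
  (fun w => r z.1 w.1)) /=.
have sumE (f : 'I_k -> nat) :
    (\sum_(z in {: 'I_k * 'I_q}) f z.1 = q * \sum_i f i)%N.
  transitivity (\sum_(i < k) \sum_(j < q) f i)%N.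
    by rewrite pair_bigA /=; apply: eq_bigl => z; rewrite inE.
  rewrite big_distrr /=; apply: eq_bigr => i _.
  by rewrite sum_nat_const card_ord.
rewrite (eq_bigr (fun z => q * \sum_j r z.1 j)%N) => [|z _]; last first.
  by rewrite (sumE (r z.1)).
by rewrite (sumE (fun i => q * \sum_j r i j)%N) -big_distrr /= mulnA.
Qed.

(** The error term [k * q] pays for the diagonal pairs, which [ud i i] counts but which carry no
    edge. *)
Lemma free_blowups (V : finType) (F : mixed_graph V) (k q : nat)
    (ud di : rel 'I_k) :
  pattern ud di -> (forall h, ~ pattern_hom F ud di h) ->
  exists G : mixed_graph 'I_#|{: 'I_k * 'I_q}|,
  [/\ free F G,
      (q ^ 2 * \sum_i \sum_j ud i j <= 2 * #|uedges G| + k * q)%N &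
      (q ^ 2 * \sum_i \sum_j di i j = #|dedges G|)%N].
Proof.
move=> pat nohom; pose n := #|{: 'I_k * 'I_q}|.
have nE : n = (k * q)%N by rewrite /n card_prod !card_ord.
pose col (x : 'I_n) := (enum_val x).1.
have [G [GU GD]] := pattern_blowup col pat.
exists G; split.
- apply/negP => /existsP[phi /and3P[_ /forallP phiU /forallP phiD]].
  apply: (nohom (fun v => col (phi v))); split => [u v|u v].
    by move/(implyP (forallP (phiD u) v)); rewrite GD.
  case/or3P => uv.
  - have /implyP/(_ uv) := forallP (phiU u) v.
    by rewrite /adjacent GU !GD; case/or3P => [/andP[_ ->]|->|->]; rewrite ?orbT.
  - by have /implyP/(_ uv) := forallP (phiD u) v; rewrite GD => ->; rewrite orbT.
  - by have /implyP/(_ uv) := forallP (phiD v) u; rewrite GD => ->; rewrite !orbT.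
- rewrite -(sum_blocks q (fun i j => ud i j : nat)) -sum_undirected -nE.
  have n1 : n = (\sum_(x < n) 1)%N by rewrite sum1_card card_ord.
  rewrite [X in (_ <= _ + X)%N]n1 -big_split /=.
  apply: leq_sum => x _.
  rewrite (bigD1 x)//= [X in (_ <= X + 1)%N](bigD1 x)//= GU eqxx /= add0n addnC.
  apply: leq_add; last by case: (ud _ _).
  by apply: leq_sum => y yx; rewrite GU eq_sym yx.
- rewrite -(sum_blocks q (fun i j => di i j : nat)).
  transitivity (\sum_x \sum_y directed G x y)%N.
    by apply: eq_bigr => x _; apply: eq_bigr => y _; rewrite GD.
  by rewrite pair_bigA /= -big_mkcond /= sum1_card; apply: eq_card => -[x y].
Qed.

(** As [q] grows, the blow-ups have undirected density tending to [u / k^2] and directed density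
    tending to [2 d / k^2], where [u] and [d] are the two sums. *)
Lemma admissible_pattern (R : realType) (V : finType) (F : mixed_graph V)
    (k : nat) (ud di : rel 'I_k) (rho : R) :
  (0 < k)%N -> pattern ud di -> (forall h, ~ pattern_hom F ud di h) ->
  admissible F rho ->
  (\sum_i \sum_j ud i j)%N%:R + 2 * rho * (\sum_i \sum_j di i j)%N%:R <= k%:R ^+ 2 :> R.
Proof.
move=> k0 pat nohom /limn_esup_le1P adm.
set u : R := _%:R; set d : R := (\sum_i \sum_j di i j)%N%:R; rewrite leNgt; apply/negP => gap.
(* Half the relative gap: the limiting value of [alpha + rho * beta] is [1 + 2 e]. *)
pose e := (u + 2 * rho * d - k%:R ^+ 2) / (2 * k%:R ^+ 2).
have k0R : 0 < k%:R :> R by rewrite ltr0n.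
have k2 : 0 < k%:R ^+ 2 :> R by rewrite exprn_gt0.
have e0 : 0 < e by rewrite divr_gt0 ?mulr_gt0//; lra.
have eE : e * k%:R ^+ 2 = (u + 2 * rho * d - k%:R ^+ 2) / 2.
  by rewrite /e; field; rewrite gt_eqF.
have [N HN] := adm _ e0.
have ek0 : 0 < e * k%:R by rewrite mulr_gt0.
(* This makes the diagonal loss [k q] at most half of the surplus [e (k q)^2]. *)
have [q1 Hq1] := exists_nat_ge 2 ek0.
pose q := (maxn N (maxn 2 q1)).
have [G [FG GU GD]] := free_blowups q pat nohom.
move: G FG GU GD; set n := #|_| => G FG GU GD.
have nE : n = (k * q)%N by rewrite /n card_prod !card_ord.
have n2 : (2 <= n)%N by rewrite nE /q; nia.
have Nn : (N <= n)%N by rewrite nE /q; nia.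
have C0 : 0 < 'C(n, 2)%:R :> R by rewrite ltr0n bin_gt0.
have {HN} : alpha R G + rho * beta R G <= 1 + e.
  apply: le_trans (HN n Nn).
  exact: (le_bigmax_cond _ (fun G => alpha R G + rho * beta R G)).
rewrite /alpha /beta mulrA -mulrDl ler_pdivrMr// => h.
have : 2 * #|uedges G|%:R + 2 * rho * #|dedges G|%:R <= (1 + e) * (n%:R * (n%:R - 1)).
  by rewrite -double_bin2; lra.
rewrite -GD natrM natrX -/d.
have : q%:R ^+ 2 * u <= 2 * #|uedges G|%:R + k%:R * q%:R.
  by rewrite /u -natrX -!natrM -natrD ler_nat.
have n0 : 0 <= n%:R :> R by [].
have -> : n%:R = k%:R * q%:R :> R by rewrite nE natrM.
have q0 : 0 < q%:R :> R by rewrite ltr0n /q !leq_max orbT.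
have qq : 2 <= e * k%:R * q%:R.
  by apply: le_trans Hq1 _; rewrite ler_pM2l// ler_nat /q !leq_max leqnn !orbT.
clearbody e; set Q : R := q%:R in q0 qq *; set K : R := k%:R in k0R eE gap qq *.
move=> h1 h2.
have : Q ^+ 2 * (u + 2 * rho * d) <= K * Q + (1 + e) * (K * Q) ^+ 2.
  have : 0 <= (1 + e) * (K * Q) by rewrite !mulr_ge0// ?ltW//; lra.
  by move: h1 h2; lra.
have : u + 2 * rho * d = 2 * (e * K ^+ 2) + K ^+ 2 by lra.
move=> ->; have : K * Q * 2 <= K * Q * (e * K * Q).
  by rewrite ler_pM2l// mulr_gt0.
have : 0 < K * Q by rewrite mulr_gt0.
by lra.
Qed.

(** A single directed pattern edge gives [q^2] directed edges among at most [(k q)^2 / 2] pairs, a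
    density of at least [2 / k^2]. *)
Lemma beta_nonvanishing (R : realType) (V : finType) (F : mixed_graph V)
    (k : nat) (ud di : rel 'I_k) (i j : 'I_k) :
  pattern ud di -> (forall h, ~ pattern_hom F ud di h) -> di i j ->
  ~ beta_vanishes R F.
Proof.
move=> pat nohom dij /cvgrPdist_lt.
have k0 : (0 < k)%N by apply: leq_ltn_trans (ltn_ord i).
have k0R : 0 < k%:R :> R by rewrite ltr0n.
have e0 : 0 < 2 / k%:R ^+ 2 :> R by rewrite divr_gt0// exprn_gt0.
move=> /(_ _ e0)[N _ HN].
have [G [FG _ GD]] := free_blowups (maxn N 2) pat nohom.
move: G FG GD; set n := #|_| => G FG GD.
have nE : n = (k * maxn N 2)%N by rewrite /n card_prod !card_ord.
have Nn : (N <= n)%N by rewrite nE; nia.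
have C0 : 0 < 'C(n, 2)%:R :> R by rewrite ltr0n bin_gt0 nE; nia.
have := HN n Nn; rewrite /= sub0r normrN ger0_norm ?bigmax_ge_id// => lt.
have : beta R G < 2 / k%:R ^+ 2.
  by apply: le_lt_trans lt; exact: (le_bigmax_cond _ (@beta R n)).
rewrite /beta ltr_pdivrMr// -GD.
have D1 : (1 <= \sum_i \sum_j di i j)%N.
  by rewrite (bigD1 i)//= (bigD1 j)//= dij.
have : 2 / k%:R ^+ 2 * 'C(n, 2)%:R <= (maxn N 2)%:R ^+ 2 :> R.
  rewrite mulrAC double_bin2 ler_pdivrMr ?exprn_gt0// -exprMn -natrM mulnC -nE expr2.
  by rewrite ler_wpM2l// lerBlDr lerDl.
have : (maxn N 2)%:R ^+ 2 <= (maxn N 2 ^ 2 * \sum_i \sum_j di i j)%N%:R :> R.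
  by rewrite -natrX ler_nat leq_pmulr.
by lra.
Qed.

(** The transitive tournament on [m = k.+2] vertices has [m (m - 1) / 2] edges, so an admissible
    [rho] satisfies [rho * m (m - 1) <= m^2]. *)
Lemma theta_le_tournament (R : realType) (V : finType) (F : mixed_graph V)
    (k : nat) :
  (forall h : V -> 'I_k.+2, ~ pattern_hom F (fun _ _ => false) (fun i j : 'I_k.+2 => (i < j)%N) h) ->
  (theta R F <= (1 + 1 / k.+1%:R)%:E)%E.
Proof.
move=> nohom.
have pat : @pattern 'I_k.+2 (fun _ _ => false) (fun i j => (i < j)%N).
  by split=> // i j ij; rewrite andbT -leqNgt ltnW.
have nv := @beta_nonvanishing R _ _ _ _ _ ord0 ord_max pat nohom isT.
have [rho [-> adm _]] := theta_max nv; rewrite lee_fin.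
have := admissible_pattern (ltn0Sn _) pat nohom adm.
rewrite big1 ?add0r => [|i _]; last by rewrite big1.
have : (2 * \sum_(i < k.+2) \sum_(j < k.+2) (i < j) = k.+2 * k.+1)%N.
  rewrite mul2n -addnn [in X in (_ + X)%N]exchange_big -big_split /=.
  rewrite -[in RHS](card_ord k.+2) -sum_nat_const; apply: eq_bigr => i _.
  rewrite -big_split /= (bigD1 i)//= ltnn add0n.
  rewrite (eq_bigr (fun=> 1%N)) => [|j ji].
    by rewrite sum1_card (cardC1 i) card_ord.
  by case: ltngtP => // /val_inj ij; rewrite ij eqxx in ji.
set D := (\sum_i \sum_j _)%N => DE.
have {}DE : 2 * D%:R = k.+2%:R * k.+1%:R :> R by rewrite -!natrM DE.
rewrite mulrAC DE [_ * rho]mulrC expr2 mulrCA ler_pM2l ?ltr0n//.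
rewrite -(natr1 k.+1) => h.
have k0 : 0 < k.+1%:R :> R by rewrite ltr0n.
have -> : 1 + 1 / k.+1%:R = (k.+1%:R + 1) / k.+1%:R :> R by field; rewrite gt_eqF.
by rewrite ler_pdivlMr.
Qed.

Lemma uncollapsible_theta_le1 (R : realType) (V : finType) (F : mixed_graph V) :
  uncollapsible F -> (theta R F <= 1%:E)%E.
Proof.
(* Part 0 is independent and all its edges leave it ([dio]) or enter it ([dii]);
   the other parts form one undirected clique. *)
pose ud k (i j : 'I_k.+2) := (0 < i)%N && (0 < j)%N.
pose dio k (i j : 'I_k.+2) := (i == ord0) && (0 < j)%N.
pose dii k (i j : 'I_k.+2) := dio k j i.
have pato k : pattern (ud k) (dio k).
  split=> [i j|i j]; first exact: andbC.
  by rewrite /ud /dio => /andP[/eqP-> _] /=; rewrite ?ltnn ?andbF.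
have pati k : pattern (ud k) (dii k).
  split=> [i j|i j]; first exact: andbC.
  by rewrite /ud /dii /dio => /andP[/eqP-> _] /=; rewrite ?ltnn ?andbF.
have udE k : (\sum_i \sum_j ud k i j = k.+1 ^ 2)%N.
  rewrite big_ord_recl /= big1// add0n.
  rewrite (eq_bigr (fun=> k.+1)) ?sum_nat_const ?card_ord// => i _.
  rewrite big_ord_recl /= add0n (eq_bigr (fun=> 1%N))// sum_nat_const card_ord.
  by rewrite muln1.
have dioE k : (\sum_i \sum_j dio k i j = k.+1)%N.
  rewrite big_ord_recl /= [X in (_ + X)%N]big1 ?addn0 => [|i _]; last by rewrite big1.
  by rewrite big_ord_recl /= add0n (eq_bigr (fun=> 1%N))// sum_nat_const card_ord muln1.
have diiE k : (\sum_i \sum_j dii k i j = k.+1)%N by rewrite exchange_big /= dioE.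
have key (di : forall k, rel 'I_k.+2) :
    (forall k, pattern (ud k) (di k)) -> (forall k, \sum_i \sum_j di k i j = k.+1)%N ->
    (forall k h, ~ pattern_hom F (ud k) (di k) h) -> (theta R F <= 1%:E)%E.
  move=> pat diE nohom.
  have [i [j ij]] : exists i j, di 0%N i j.
    apply: contrapT => H; have := diE 0%N; rewrite big1// => i _; rewrite big1// => j _.
    by apply/eqP; rewrite eqb0; apply/negP => ij; apply: H; exists i, j.
  have nv := @beta_nonvanishing R _ _ _ _ _ _ _ (pat 0%N) (nohom 0%N) ij.
  have [rho [-> adm _]] := theta_max nv; rewrite lee_fin leNgt; apply/negP => rho1.
  have r0 : 0 < rho - 1 by rewrite subr_gt0.
  (* The pattern inequality [(k+1)^2 + 2 rho (k+1) <= (k+2)^2] means [rho - 1 <= 1 / (2 (k+1))],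
     which fails once [k (rho - 1) >= 1]. *)
  have [k Hk] := exists_nat_ge 1 r0.
  have := admissible_pattern (ltn0Sn _) (pat k) (nohom k) adm.
  rewrite udE diE natrX -(natr1 k.+1) -(natr1 k).
  have : 0 <= k%:R :> R by [].
  nra.
(* Two adjacent heads, or two adjacent tails, would both map to part 0, which spans no edge. *)
case/orP => /existsP[u /existsP[v /and3P[/existsP[u' uu'] /existsP[v' vv'] uv]]].
- apply: (key dii) => // k h [hd ha].
  have /andP[/eqP hu _] := hd _ _ uu'; have /andP[/eqP hv _] := hd _ _ vv'.
  by have := ha _ _ uv; rewrite /ud /dii /dio hu hv.
- apply: (key dio) => // k h [hd ha].
  have /andP[/eqP hu _] := hd _ _ uu'; have /andP[/eqP hv _] := hd _ _ vv'.
  by have := ha _ _ uv; rewrite /ud /dio hu hv.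
Qed.

Lemma theta_ge1 (R : realType) (V : finType) (F : mixed_graph V) :
  (1%:E <= theta R F)%E.
Proof.
rewrite /theta; case: asboolP => _; first exact: leey.
apply: ereal_sup_ubound; exists 1 => //.
apply/limn_esup_le1P => e e0; exists 0%N => n _.
apply: bigmax_le => [|G _]; first by lra.
by rewrite mul1r; have := alpha_beta_le1 R G; lra.
Qed.

(** * Colorings of F and the bounds they give *)

Lemma chromatic_numberP (V : finType) (F : mixed_graph V) :
  (exists c : V -> nat, (forall v, (c v < chromatic_number F)%N) /\
    forall u v, adjacent F u v -> c u != c v) /\
  forall k (c : V -> 'I_k), (k < chromatic_number F)%N ->
    ~ (forall u v, adjacent F u v -> c u != c v).
Proof.
rewrite /chromatic_number; case: ex_minnP => m /existsP[c cF] mmin; split.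
  exists (fun v => c v : nat); split=> [v|u v]; first exact: ltn_ord.
  by move/(implyP (forallP (forallP cF u) v)).
move=> k d km dF; have : colorable F k.
  apply/existsP; exists [ffun v => d v].
  apply/forallP => u; apply/forallP => v; apply/implyP => uv.
  by rewrite !ffunE dF.
by move/mmin; rewrite leqNgt km.
Qed.

Lemma collapsible_coloring (V : finType) (F : mixed_graph V) :
  collapsible F -> exists c, directed_edge_coloring F (chromatic_number F).+2 c.
Proof.
rewrite /collapsible negb_or => /andP[/existsPn Hh /existsPn Ht].
have [[c [ck cadj]] _] := chromatic_numberP F.
have hh u v : head_vertex F u -> head_vertex F v -> ~~ adjacent F u v.
  by move=> hu hv; have /existsPn/(_ v) := Hh u; rewrite hu hv.
have tt u v : tail_vertex F u -> tail_vertex F v -> ~~ adjacent F u v.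
  by move=> hu hv; have /existsPn/(_ v) := Ht u; rewrite hu hv.
exists (fun v => if tail_vertex F v then 0 else if head_vertex F v then 1 else (c v).+2)%N.
split.
- by move=> v; case: ifP => // _; case: ifP => // _; rewrite !ltnS.
- move=> u v uv; have := tt u v; have := hh u v; rewrite uv /=.
  case: (tail_vertex F u) (tail_vertex F v) => [] [] ht' th';
    rewrite ?(negbTE (th' isT isT)) //; try by have := th' isT isT.
  + by case: (head_vertex F v).
  + by case: (head_vertex F u).
  + case: (head_vertex F u) (head_vertex F v) ht' => [] [] // ht'.
      by have := ht' isT isT.
    by rewrite !eqSS cadj.
- move=> u v uv.
  have tu : tail_vertex F u by apply/existsP; exists v.
  have hv : head_vertex F v by apply/existsP; exists u.
  (* The head [v] does get color 1: were it also a tail, it would be a tail adjacent to the tail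
     [u]. *)
  rewrite tu hv; case: ifP => // tv.
  by have := tt u v tu tv; rewrite /adjacent uv orbT.
Qed.

Lemma one_directed_edge_coloring (V : finType) (F : mixed_graph V) :
  (#|dedges F| <= 1)%N -> (2 <= chromatic_number F)%N ->
  exists c, directed_edge_coloring F (chromatic_number F) c.
Proof.
move=> d1; have [[c [ck cadj]] _] := chromatic_numberP F.
move: (chromatic_number F) ck => k ck k2.
have [/existsP[[u0 v0] uv0]|/existsPn no] := boolP [exists p, p \in dedges F]; last first.
  by exists c; split => // u v uv; have := no (u, v); rewrite -[_ \in _]/(directed F u v) uv.
have cuv : c u0 != c v0 by apply: cadj; rewrite /adjacent [directed F u0 v0]uv0 orbT.
(* transpose [c u0] with 0, then the new color of [v0] with 1 *)
pose sw i j x := if x == i then j else if x == j then i else x : nat.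
have swI i j : injective (sw i j).
  by move=> x y; rewrite /sw; do 4?[case: eqP => //]; lia.
have swk i j x : (i < k)%N -> (j < k)%N -> (x < k)%N -> (sw i j x < k)%N.
  by rewrite /sw; do 2?[case: eqP].
pose s x := sw (sw (c u0) 0%N (c v0)) 1%N (sw (c u0) 0%N x).
have sI : injective s by move=> x y /swI/swI.
exists (fun v => s (c v)); split.
- by move=> v; rewrite /s !swk//; lia.
- by move=> u v uv; rewrite (inj_eq sI) cadj.
move=> u v uv; have [-> ->] : u = u0 /\ v = v0.
  have := card_le1_eqP d1 (u, v) (u0, v0) uv uv0.
  by case.
rewrite /s /sw !eqxx; move: cuv.
by split; do ?[case: eqP => //]; lia.
Qed.

Lemma head_monochromatic_coloring (V : finType) (F : mixed_graph V) :
  head_monochromatic_2colorable F -> exists c, directed_edge_coloring F 2 c.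
Proof.
case=> c [cF [i hi]].
have cadj u v : adjacent F u v -> c u != c v.
  by move/(implyP (forallP (forallP cF u) v)).
have I2 (x y z : 'I_2) : x != y -> (x == z) != (y == z).
  by case: x y z => [[|[|//]] ?] [[|[|//]] ?] [[|[|//]] ?].
(* Heads receive 1, and a tail, being adjacent to a head, receives 0. *)
exists (fun v => c v == i : nat); split.
- by move=> v; case: (_ == _).
- by move=> u v /cadj/(I2 _ _ i) /=; case: (c u == i); case: (c v == i).
move=> u v uv; have cv : c v = i by apply: hi; apply/existsP; exists u.
have : c u != c v by apply: cadj; rewrite /adjacent uv orbT.
by rewrite cv eqxx => /negPf ->.
Qed.

(** A homomorphism to the tournament on [k.+2] vertices is in particular a proper coloring with one
    color fewer than the chromatic number. *)
Lemma theta_le_chromatic (R : realType) (V : finType) (F : mixed_graph V) (k : nat) :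
  chromatic_number F = k.+3 -> (theta R F <= (1 + 1 / k.+1%:R)%:E)%E.
Proof.
move=> Fk; apply: theta_le_tournament => h [_ ha].
have [_ noc] := chromatic_numberP F; apply: (noc _ h); first by rewrite Fk.
by move=> u v /ha /= /orP[]; apply: contraTneq => ->; rewrite ltnn.
Qed.

Lemma theta_le2 (R : realType) (V : finType) (F : mixed_graph V) :
  ~ head_monochromatic_2colorable F -> (theta R F <= 2%:E)%E.
Proof.
move=> nhm; have -> : 2 = 1 + 1 / 1%:R :> R by rewrite divr1.
apply: theta_le_tournament => h [hd ha]; apply: nhm; exists [ffun v => h v]; split.
  apply/forallP => u; apply/forallP => v; apply/implyP => /ha /=; rewrite !ffunE.
  by case/orP; apply: contraTneq => ->; rewrite ltnn.
(* In the tournament on two vertices, the only edge enters [ord_max], so all heads map there. *)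
exists ord_max => v /existsP[u /hd]; rewrite ffunE => uv; apply: val_inj => /=.
by move: uv (ltn_ord (h v)); lia.
Qed.

Theorem theorem1p6 (R : realType) (V : finType) (F : mixed_graph V) :
  [/\ theta R F = 1%E <-> uncollapsible F,
      (theta R F = +oo%E <-> head_monochromatic_2colorable F) /\
      (~ head_monochromatic_2colorable F -> (theta R F <= 2%:E)%E),
      (#|dedges F| <= 1)%N -> (3 <= chromatic_number F)%N ->
        theta R F = (1 + 1 / ((chromatic_number F)%:R - 2))%:E &
      collapsible F -> (2 <= #|dedges F|)%N ->
        ((1 + 1 / (chromatic_number F)%:R)%:E <= theta R F)%E /\
        (theta R F <= if chromatic_number F == 2%N then +oo
                      else (1 + 1 / ((chromatic_number F)%:R - 2))%:E)%E].
Proof.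
have sub2 m : m.+3%:R - 2 = m.+1%:R :> R by rewrite -(natrB _ (isT : 2 <= m.+3)%N) subSS subSS.
split.
- split=> [t1|unc]; last first.
    by apply/le_anti; rewrite uncollapsible_theta_le1// theta_ge1.
  apply: contraT => /collapsible_coloring[c [ck cadj cdir]].
  (* A spare color brings the count to the form [k.+3] even if the chromatic number is 0; the
     resulting bound still exceeds 1. *)
  have cF : directed_edge_coloring F (chromatic_number F).+3 c.
    by split => // v; apply: ltnW; rewrite ltnS.
  have := theta_ge R cF; rewrite t1 lee_fin gerDl leNgt.
  by rewrite divr_gt0// ltr0n.
- split; last exact: theta_le2.
  split=> [too|/head_monochromatic_coloring[c cF]].
    by apply: contrapT => /(theta_le2 R); rewrite too.
  by rewrite /theta asboolT//; apply: beta_vanishes_coloring cF.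
- move=> d1 chi3; have [c cF] := one_directed_edge_coloring d1 (ltnW chi3).
  move: chi3 cF; case Fk: (chromatic_number F) => [|[|[|k]]]// _ cF.
  by rewrite sub2; apply/le_anti; rewrite (theta_ge R cF) theta_le_chromatic.
- move=> /collapsible_coloring[c cF] d2.
  have chi2 : (2 <= chromatic_number F)%N.
    have [[u v] uv] : exists p, p \in dedges F by apply/card_gt0P/ltnW.
    have [[d [dk dadj]] _] := chromatic_numberP F.
    have : d u != d v by apply: dadj; rewrite /adjacent [directed F u v]uv orbT.
    by move: (dk u) (dk v); lia.
  move: chi2 cF; case Fk: (chromatic_number F) => [|[|k]]// _ cF.
  split; first exact: theta_ge cF.
  case: k Fk cF => [|k] Fk cF /=; first exact: leey.
  by rewrite sub2; apply: theta_le_chromatic.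
Qed.
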